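(* Let $I=(0,1)$, let $B\subset\mathbb{R}$ be finite such that the union $B+I=\bigcup_{b\in B}(b+I)$ is non-overlapping (pairwise Lebesgue null intersections), and let $\Lambda\subset\mathbb{R}$. Assume that $(B+I,\Lambda)$ is a spectral pair. Then $\Lambda=L+\mathbb{Z}$ for some finite set $L\subset\mathbb{R}$ with $|L|=|B|$ such that the union $L+\mathbb{Z}=\bigcup_{\ell\in L}(\ell+\mathbb{Z})$ is non-overlapping (disjoint), and $b-b'\in\mathbb{Z}$ for all $b,b'\in B$. Moreover, the matrix $$\bigl(|B|^{-1/2}e^{i2\pi b\ell}\bigr)_{b\in B,\,\ell\in L}$$ is unitary.
   Context: $e_\lambda(x):=e^{i2\pi\lambda x}$. For a measurable set $S\subset\mathbb{R}$ of finite positive Lebesgue measure and $\Lambda\subset\mathbb{R}$, $(S,\Lambda)$ is a spectral pair if (the restrictions to $S$ of) $\{e_\lambda:\lambda\in\Lambda\}$ form an orthogonal basis of $L^2(S)$ (Lebesgue measure). *)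

(* Defs.v *)
From HB Require Import structures.
From mathcomp Require Import all_boot all_order all_algebra.
From mathcomp Require Import finmap.
From mathcomp Require Import spectral.
From mathcomp Require Import complex.
From mathcomp Require Import all_classical all_reals all_analysis.

Set Implicit Arguments.
Unset Strict Implicit.
Unset Printing Implicit Defensive.

Import Order.TTheory GRing.Theory Num.Theory.
Import numFieldNormedType.Exports.

Local Open Scope classical_set_scope.
Local Open Scope ring_scope.

Definition translate (R : realType) (a : R) (X : set R) : set R :=
  [set a + x | x in X].

Definition sumset (R : realType) (A X : set R) : set R :=
  \bigcup_(a in A) translate a X.

Definition integers (R : realType) : set R := [set x | x \is a Num.int].

Definition essentially_disjoint (R : realType) (A X : set R) : Prop :=
  forall a a' : R, A a -> A a' -> a <> a' ->
    lebesgue_measure (translate a X `&` translate a' X) = 0%E.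

(* e_lam (x) = exp (i 2 pi lam x), through Euler's formula *)
Definition exponential (R : realType) (lam x : R) : R[i] :=
  Complex (cos (2 * pi * lam * x)) (sin (2 * pi * lam * x)).

Definition cintegral (R : realType) (S : set R) (f : R -> R[i]) : R[i] :=
  Complex (Rintegral lebesgue_measure S (fun x => complex.Re (f x)))
          (Rintegral lebesgue_measure S (fun x => complex.Im (f x))).

(* squared norm of L^2(S), [+oo] when f is not square integrable *)
Definition L2normsq (R : realType) (S : set R) (f : R -> R[i]) : \bar R :=
  (\int[lebesgue_measure]_(x in S)
     ((complex.Re (f x)) ^+ 2 + (complex.Im (f x)) ^+ 2)%:E)%E.

(* Elements of L^2(S) are represented by functions defined on the whole line,
   whose values outside S are irrelevant. [measurable_fun] is Borel
   measurability: every class of L^2(S) has such a representative. *)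
Definition L2 (R : realType) (S : set R) (f : R -> R[i]) : Prop :=
  [/\ measurable_fun S (fun x => complex.Re (f x)),
      measurable_fun S (fun x => complex.Im (f x)) &
      (L2normsq S f < +oo)%E].

Definition L2inner (R : realType) (S : set R) (f g : R -> R[i]) : R[i] :=
  cintegral S (fun x => f x * conjc (g x)).

(* orthogonal family of nonzero vectors of L^2(S) with dense linear span *)
Definition orthogonal_basis (R : realType) (S : set R)
    (J : choiceType) (D : set J) (e : J -> R -> R[i]) : Prop :=
  [/\ forall i, D i -> L2 S (e i) /\ (0 < L2normsq S (e i))%E,
      forall i j, D i -> D j -> i <> j -> L2inner S (e i) (e j) = 0 &
      forall f : R -> R[i], L2 S f -> forall eps : R, 0 < eps ->
        exists (F : {fset J}) (c : J -> R[i]), [set` F] `<=` D /\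
          (L2normsq S (fun x => f x - \sum_(i <- F) c i * e i x)%R
             < (eps ^+ 2)%:E)%E].

Definition spectral_pair (R : realType) (S Lam : set R) : Prop :=
  [/\ measurable S, (0 < lebesgue_measure S < +oo)%E &
      orthogonal_basis S Lam (@exponential R)].

(* rows and columns follow the canonical enumerations of B and L *)
Definition exponential_matrix (R : realType) (B L : {fset R}) :
    'M[R[i]]_(#|` B|, #|` L|) :=
  \matrix_(i < #|` B|, j < #|` L|)
    (real_complex R (Num.sqrt (#|` B|%:R))^-1 *
     exponential (enum_fset L)`_j (enum_fset B)`_i).

(* [unitarymx] is the one-sided condition U U^* = 1 *)
Definition unitary (C : numClosedFieldType) (m n : nat) (U : 'M[C]_(m, n)) :
    Prop :=
  U \is unitarymx /\ map_mx Num.conj U^T \is unitarymx.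

(* Main.v *)
Require Import Defs.
From HB Require Import structures.
From mathcomp Require Import all_boot all_order all_algebra.
From mathcomp Require Import finmap.
From mathcomp Require Import complex.
From mathcomp Require Import all_classical all_reals all_analysis.
From mathcomp Require Import spectral measurable_realfun.
From mathcomp Require Import ring lra.
Import Order.TTheory GRing.Theory Num.Theory.
Import numFieldNormedType.Exports.
Local Open Scope classical_set_scope.
Local Open Scope ring_scope.

Set Implicit Arguments.
Unset Strict Implicit.
Unset Printing Implicit Defensive.

(** Write [S = B + I], [B^(nu)] for the sum of the [e_nu(b)], [b] in [B], and
    [I^(nu)] for the integral of [e_nu] over [I = (0,1)]. Then

      <e_lam, e_mu> = B^(lam - mu) I^(lam - mu),

    and [I^] vanishes exactly at the nonzero integers. The pair [(S, Lam)] is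
    used only through the following two consequences of its spectrality.

    - Orthogonality ([spectral_pair_mask]): if [lam] and [mu] are in [Lam] and
      [lam - mu] is not an integer, then [B^(lam - mu) = 0], because [I^] does
      not vanish there.
    - Totality ([spectral_pair_total]), tested on the functions equal to
      [v_b e_lam] on [b + I], with an amplitude [v_b] that depends on the
      interval: the scalar product of such a function with [e_mu] is [I^(lam -
      mu)] times the sum of the [v_b e_(lam - mu)(b)]. If this is zero for
      every [mu] in [Lam], then [v] is zero on [B].

    Everything else follows from modulating each interval separately. Let
    [lam] be in [Lam], let [s] be an integer, and multiply [e_lam] on [b + I]
    by [e_s(x - b)], a function that has period 1 and is the same on all
    intervals. In the notation above, this is the amplitude [e_(-s)(b)] at the
    frequency [lam + s]. Its sum against [e_mu] is [B^(lam - mu)], which is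
    zero by orthogonality unless [lam - mu] is an integer, and [I^] kills all
    the remaining [mu] except [mu = lam + s]. Hence [lam + s] is in [Lam]
    ([spectrum_periodic]), and for [s = 1] the modulated function is a
    multiple of [e_(lam + 1)]: the number [e_(-1)(b)] does not depend on [b],
    so that all differences [b - b'] are integers ([sub_int_of_spectrum]).

    Now [Lam] is determined by [L], its part in [[0,1[]. Orthogonality says
    that the columns of the normalized matrix [e_l(b)] are orthonormal, so
    [|L| <= |B|]; conversely, a vector [v] orthogonal to all the vectors
    [(e_l(b))_b] gives a function that is constant on each interval and
    orthogonal to all [e_mu], so totality yields [|B| <= |L|]. The matrix is
    then square with orthonormal columns, hence unitary. *)

(** * Characters of the real line *)

Lemma exponential0l (R : realType) (x : R) : exponential 0 x = 1.
Proof. by rewrite /exponential mulr0 mul0r cos0 sin0. Qed.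

Lemma exponential0r (R : realType) (lam : R) : exponential lam 0 = 1.
Proof. by rewrite /exponential mulr0 cos0 sin0. Qed.

Lemma exponentialC (R : realType) (lam x : R) :
  exponential lam x = exponential x lam.
Proof. by rewrite /exponential mulrAC. Qed.

Lemma exponentialDl (R : realType) (lam mu x : R) :
  exponential (lam + mu) x = exponential lam x * exponential mu x.
Proof.
rewrite /exponential !mulrDr mulrDl cosD sinD.
by apply/eqP; rewrite eq_complex /= addrC [X in _ + X]mulrC addrC !eqxx/= addrC.
Qed.

Lemma exponentialDr (R : realType) (lam x y : R) :
  exponential lam (x + y) = exponential lam x * exponential lam y.
Proof. by rewrite !(exponentialC lam) exponentialDl. Qed.

Lemma conjc_exponential (R : realType) (lam x : R) :
  conjc (exponential lam x) = exponential (- lam) x.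
Proof. by rewrite /exponential mulrN mulNr cosN sinN. Qed.

Lemma exponentialVl (R : realType) (lam x : R) :
  exponential lam x * exponential (- lam) x = 1.
Proof. by rewrite -exponentialDl subrr exponential0l. Qed.

Lemma exponential_neq0 (R : realType) (lam x : R) : exponential lam x != 0.
Proof.
apply/eqP => e0; have := exponentialVl lam x.
by rewrite e0 mul0r => /esym/eqP; rewrite oner_eq0.
Qed.

Lemma exponential_nat (R : realType) (n : nat) : exponential (n%:R : R) 1 = 1.
Proof.
elim: n => [|n IH]; first by rewrite exponential0l.
rewrite -natr1 exponentialDl IH mul1r /exponential !mulr1.
by rewrite mulr_natl cos2pi sin2pi.
Qed.

(** After subtracting the integer part of [lam * x], it remains to exclude
    [0 < r < 1]. There [cos (2 pi r) = 1 - 2 sin (pi r) ^ 2] is less than 1,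
    since [sin (pi r)] is positive. *)
Lemma exponential_eq1 (R : realType) (lam x : R) :
  (exponential lam x == 1) = (lam * x \is a Num.int).
Proof.
have -> : exponential lam x = exponential (lam * x) 1.
  by rewrite /exponential mulr1 mulrA.
move: (lam * x) => {x lam} y.
have eint (k : R) : k \is a Num.int -> exponential k 1 = 1.
  rewrite intrE => /orP[] /natrP[n kE]; first by rewrite kE exponential_nat.
  by have := exponentialVl k 1; rewrite kE exponential_nat mulr1.
apply/idP/idP => [/eqP|/eint ->//].
set r := y - (Num.floor y)%:~R => ey.
have er : exponential r 1 = 1.
  have := exponentialDl r (Num.floor y)%:~R 1.
  by rewrite subrK ey (eint _%:~R) ?mulr1 // intr_int.
have r0 : 0 <= r by rewrite subr_ge0 floor_le.
have r1 : r < 1 by rewrite ltrBlDl -[X in _ + X]/(1%:~R) -intrD floorD1_gt.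
have [/eqP|rn0] := eqVneq r 0.
  by rewrite subr_eq0 => /eqP ->; exact: intr_int.
have {rn0}r0 : 0 < r by rewrite lt_neqAle eq_sym rn0.
have spi : 0 < sin (pi * r).
  by apply: sin_gt0_pi; rewrite mulr_gt0 ?pi_gt0//= gtr_pMr ?pi_gt0.
have : cos (2 * pi * r * 1) = 1 by have := congr1 (@complex.Re R) er.
rewrite mulr1 -mulrA mulr_natl cos_mulr2n cos2sin2 => cE.
have : sin (pi * r) ^+ 2 = 0 by lra.
by move/eqP; rewrite sqrf_eq0 (gt_eqF spi).
Qed.

(** * Integration of bounded measurable functions *)

(** An algebra of functions, stable under conjugation, all of whose elements
    are integrable on every set of finite measure; it contains every function
    whose integral is needed, so that linearity of the integral comes without
    further integrability conditions. *)
Definition bounded_measurable (R : realType) (f : R -> R[i]) : Prop :=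
  [/\ measurable_fun setT (fun x => complex.Re (f x)),
      measurable_fun setT (fun x => complex.Im (f x)) &
      exists M, forall x, `|complex.Re (f x)| <= M /\ `|complex.Im (f x)| <= M].

Lemma ReM (R : realType) (z w : R[i]) :
  complex.Re (z * w) =
  complex.Re z * complex.Re w - complex.Im z * complex.Im w.
Proof. by case: z w => [a b] [c d]. Qed.

Lemma ImM (R : realType) (z w : R[i]) :
  complex.Im (z * w) =
  complex.Re z * complex.Im w + complex.Im z * complex.Re w.
Proof. by case: z w => [a b] [c d]. Qed.

Lemma ReD (R : realType) (z w : R[i]) :
  complex.Re (z + w) = complex.Re z + complex.Re w.
Proof. by case: z w => [a b] [c d]. Qed.

Lemma ImD (R : realType) (z w : R[i]) :
  complex.Im (z + w) = complex.Im z + complex.Im w.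
Proof. by case: z w => [a b] [c d]. Qed.

Lemma bounded_measurable_cst (R : realType) (c : R[i]) :
  bounded_measurable (fun _ : R => c).
Proof.
split; [exact: measurable_cst | exact: measurable_cst |].
exists (`|complex.Re c| + `|complex.Im c|) => x.
by rewrite lerDl lerDr !normr_ge0.
Qed.

Lemma bounded_measurableD (R : realType) (f g : R -> R[i]) :
  bounded_measurable f -> bounded_measurable g ->
  bounded_measurable (fun x => f x + g x).
Proof.
move=> [rf jf [M fM]] [rg jg [N gN]]; split.
- by under eq_fun do rewrite ReD; exact: measurable_funD.
- by under eq_fun do rewrite ImD; exact: measurable_funD.
exists (M + N) => x; have [f1 f2] := fM x; have [g1 g2] := gN x.
by rewrite ReD ImD; split; apply: le_trans (ler_normD _ _) _; exact: lerD.
Qed.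

Lemma bounded_measurableM (R : realType) (f g : R -> R[i]) :
  bounded_measurable f -> bounded_measurable g ->
  bounded_measurable (fun x => f x * g x).
Proof.
move=> [rf jf [M fM]] [rg jg [N gN]]; split.
- by under eq_fun do rewrite ReM; apply: measurable_funB; exact: measurable_funM.
- by under eq_fun do rewrite ImM; apply: measurable_funD; exact: measurable_funM.
exists (M * N + M * N) => x; have [f1 f2] := fM x; have [g1 g2] := gN x.
rewrite ReM ImM.
by split; [apply: le_trans (ler_normB _ _) _|apply: le_trans (ler_normD _ _) _];
  rewrite !normrM; apply: lerD; apply: ler_pM.
Qed.

Lemma bounded_measurable_conjc (R : realType) (f : R -> R[i]) :
  bounded_measurable f -> bounded_measurable (fun x => conjc (f x)).
Proof.
move=> [rf jf [M fM]].
have rE x : complex.Re (conjc (f x)) = complex.Re (f x) by case: (f x).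
have jE x : complex.Im (conjc (f x)) = - complex.Im (f x) by case: (f x).
split.
- by under eq_fun do rewrite rE.
- by under eq_fun do rewrite jE; exact: measurableT_comp.
by exists M => x; rewrite rE jE normrN; exact: fM.
Qed.

Lemma bounded_measurable_sum (R : realType) (I : Type) (s : seq I)
    (f : I -> R -> R[i]) :
  (forall i, bounded_measurable (f i)) ->
  bounded_measurable (fun x => \sum_(i <- s) f i x).
Proof.
move=> bf; elim: s => [|i s IH].
  by under eq_fun do rewrite big_nil; exact: bounded_measurable_cst.
by under eq_fun do rewrite big_cons; exact: bounded_measurableD.
Qed.

Lemma bounded_measurable_exponential (R : realType) (lam : R) :
  bounded_measurable (exponential lam).
Proof.
have lin : continuous (fun x : R => 2 * pi * lam * x) by exact: mulrl_continuous.
split => /=.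
- apply: continuous_measurable_fun => x.
  by apply: continuous_comp; [exact: lin | exact: continuous_cos].
- apply: continuous_measurable_fun => x.
  by apply: continuous_comp; [exact: lin | exact: continuous_sin].
by exists 1 => x; rewrite cos_max sin_max.
Qed.

Lemma bounded_measurable_indic (R : realType) (A : set R) :
  measurable A -> bounded_measurable (fun x => (\1_A x)%:C%C : R[i]).
Proof.
move=> mA; split => /=.
- exact: measurable_indic.
- exact: measurable_cst.
exists 1 => x; rewrite normr0 ler01 indicE.
by case: (x \in A); rewrite ?normr1 ?normr0.
Qed.

Section integral.
Variables (R : realType) (S : set R).
Hypotheses (mS : measurable S) (finS : (lebesgue_measure S < +oo)%E).

Lemma bounded_integrable (f : R -> R) (M : R) :
  measurable_fun setT f -> (forall x, `|f x| <= M) ->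
  lebesgue_measure.-integrable S (EFin \o f).
Proof.
move=> mf fM; apply: measurable_bounded_integrable => //.
  exact: measurable_funTS.
exists M; split; first exact: num_real.
by move=> N MN x _ /=; apply: le_trans (fM x) (ltW MN).
Qed.

Lemma bounded_measurable_integrable (f : R -> R[i]) :
  bounded_measurable f ->
  lebesgue_measure.-integrable S (EFin \o (fun x => complex.Re (f x))) /\
  lebesgue_measure.-integrable S (EFin \o (fun x => complex.Im (f x))).
Proof.
move=> [rf jf [M fM]].
by split; apply: bounded_integrable (M) _ _ => // x; have [] := fM x.
Qed.

Lemma cintegralD (f g : R -> R[i]) :
  bounded_measurable f -> bounded_measurable g ->
  cintegral S (fun x => f x + g x) = cintegral S f + cintegral S g.
Proof.
move=> /bounded_measurable_integrable[rf jf].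
move=> /bounded_measurable_integrable[rg jg].
rewrite /cintegral; congr Complex.
  by under eq_Rintegral do rewrite ReD; rewrite RintegralD.
by under eq_Rintegral do rewrite ImD; rewrite RintegralD.
Qed.

Lemma cintegralZ (c : R[i]) (f : R -> R[i]) :
  bounded_measurable f ->
  cintegral S (fun x => c * f x) = c * cintegral S f.
Proof.
move=> /bounded_measurable_integrable[rf jf].
have intZ r (h : R -> R) : lebesgue_measure.-integrable S (EFin \o h) ->
    lebesgue_measure.-integrable S (EFin \o (fun x => r * h x)).
  move=> ih; rewrite (_ : EFin \o _ = (fun x => r%:E * (EFin \o h) x)%E)//.
  exact: integrableZl.
case: c => a b; rewrite /cintegral; congr Complex.
  under eq_Rintegral do rewrite ReM/=.
  by rewrite RintegralB ?RintegralZl//; exact: intZ.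
under eq_Rintegral do rewrite ImM/=.
by rewrite RintegralD ?RintegralZl//; exact: intZ.
Qed.

Lemma cintegral_sum (I : Type) (s : seq I) (f : I -> R -> R[i]) :
  (forall i, bounded_measurable (f i)) ->
  cintegral S (fun x => \sum_(i <- s) f i x) = \sum_(i <- s) cintegral S (f i).
Proof.
move=> bf; elim: s => [|i s IH].
  rewrite big_nil /cintegral; congr Complex.
    by under eq_Rintegral do rewrite big_nil/=; rewrite Rintegral_cst// mul0r.
  by under eq_Rintegral do rewrite big_nil/=; rewrite Rintegral_cst// mul0r.
rewrite big_cons -IH -cintegralD//; last exact: bounded_measurable_sum.
by congr (cintegral S _); apply/funext => x; rewrite big_cons.
Qed.

End integral.

Lemma eq_cintegral (R : realType) (S : set R) (f g : R -> R[i]) :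
  (forall x, S x -> f x = g x) -> cintegral S f = cintegral S g.
Proof.
move=> fg; rewrite /cintegral; congr Complex.
  by apply: eq_Rintegral => x; rewrite inE => /fg ->.
by apply: eq_Rintegral => x; rewrite inE => /fg ->.
Qed.

(** * The Fourier transform of the unit interval *)

Lemma Rintegral_derive_itv (R : realType) (F f : R -> R) (a b : R) :
  a < b -> continuous f -> (forall x : R, is_derive x 1 F (f x)) ->
  \int[lebesgue_measure]_(x in `]a, b[) f x = F b - F a.
Proof.
move=> ab cf dF.
have cF : continuous F.
  by move=> x; apply: differentiable_continuous; apply/derivable1_diffP; case: (dF x).
have mf A : measurable_fun A (EFin \o f).
  by apply/measurable_EFinP/measurable_funTS; exact: continuous_measurable_fun.
rewrite /Rintegral -(integral_itv_bndoo true false (mf _)).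
rewrite (continuous_FTC2 ab (F := F))//.
- exact: continuous_subspaceT.
- split=> [x _||]; first by case: (dF x).
    exact: cvg_at_right_filter (cF a).
  exact: cvg_at_left_filter (cF b).
- by move=> x _; rewrite derive1E; case: (dF x).
Qed.

(** The fundamental theorem of calculus for [e_nu], whose derivative is
    [2 i pi nu e_nu]; the factor is kept on the left so that [nu = 0] needs no
    separate treatment. *)
Lemma cintegral_exponential_itv (R : realType) (a b nu : R) : a < b ->
  cintegral `]a, b[ (exponential nu) * Complex 0 (2 * pi * nu) =
  exponential nu b - exponential nu a.
Proof.
move=> ab; rewrite /exponential; set w := 2 * pi * nu.
have clin : continuous (fun x : R => w * x) by exact: mulrl_continuous.
have ccos : continuous (fun x : R => cos (w * x)).
  by move=> x; apply: continuous_comp; [exact: clin | exact: continuous_cos].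
have csin : continuous (fun x : R => sin (w * x)).
  by move=> x; apply: continuous_comp; [exact: clin | exact: continuous_sin].
have dlin (x : R) : is_derive x 1 (fun y : R => w * y) w.
  rewrite -[X in is_derive _ _ _ X](mulr1 w).
  exact: (is_deriveZ w (is_derive_id x (1 : R))).
have bnd (h : R -> R) : measurable_fun setT h -> (forall x, `|h x| <= 1) ->
    lebesgue_measure.-integrable `]a, b[%classic (EFin \o h).
  move=> mh hle1; apply: (bounded_integrable _ _ mh hle1) => //.
  by rewrite /= lebesgue_measure_itv/= lte_fin ab -EFinB ltry.
have intcos := bnd _ (continuous_measurable_fun ccos) (fun x => cos_max _).
have intsin := bnd _ (continuous_measurable_fun csin) (fun x => sin_max _).
have Ecos : w * \int[lebesgue_measure]_(x in `]a, b[) cos (w * x) =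
            sin (w * b) - sin (w * a).
  rewrite -RintegralZl//.
  apply: (Rintegral_derive_itv (F := fun x => sin (w * x)) ab) => [x|x].
    by apply: cvgM; [exact: cvg_cst | exact: ccos].
  rewrite mulrC.
  exact: (is_derive1_comp (is_derive_sin _) (dlin x)).
have Esin : - w * \int[lebesgue_measure]_(x in `]a, b[) sin (w * x) =
            cos (w * b) - cos (w * a).
  rewrite -RintegralZl//.
  apply: (Rintegral_derive_itv (F := fun x => cos (w * x)) ab) => [x|x].
    by apply: cvgM; [exact: cvg_cst | exact: csin].
  rewrite mulrC mulrN -mulNr.
  exact: (is_derive1_comp (is_derive_cos _) (dlin x)).
apply/eqP; rewrite eq_complex ReM ImM !ReD !ImD /= -Ecos -Esin.
by rewrite !mulr0 addr0 sub0r mulNr !(mulrC w) !eqxx.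
Qed.

(** The Fourier transform of the unit interval, at the frequency [- nu]. *)
Definition unit_transform (R : realType) (nu : R) : R[i] :=
  cintegral `]0, 1[ (exponential nu).

Lemma lebesgue_measure_unit_itv (R : realType) (b : R) :
  (lebesgue_measure (`]b, (b + 1)%R[%classic : set R) = 1)%E.
Proof.
by rewrite lebesgue_measure_itv/= lte_fin ltrDl ltr01 -EFinB addrAC subrr add0r.
Qed.

Lemma cintegral_cst_unit_itv (R : realType) (b : R) (c : R[i]) :
  cintegral `]b, b + 1[ (fun _ => c) = c.
Proof.
case: c => c1 c2; rewrite /cintegral !Rintegral_cst//=.
by rewrite lebesgue_measure_unit_itv !mulr1.
Qed.

Lemma cintegral_exponential_translate (R : realType) (b nu : R) :
  cintegral `]b, b + 1[ (exponential nu) = exponential nu b * unit_transform nu.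
Proof.
have [->|nu0] := eqVneq nu 0.
  rewrite exponential0l mul1r /unit_transform.
  rewrite !(eq_cintegral (g := fun=> 1)) => [|x _|x _]; rewrite ?exponential0l//.
  by rewrite -{2}[1]add0r !cintegral_cst_unit_itv.
have w0 : Complex 0 (2 * pi * nu) != 0 :> R[i].
  rewrite eq_complex/= eqxx/= !mulf_neq0//.
  by rewrite gt_eqF// pi_gt0.
have lt_b : b < b + 1 by rewrite ltrDl.
set w := Complex 0 _ in w0 *.
have E : cintegral `]b, b + 1[ (exponential nu) * w =
    exponential nu b * unit_transform nu * w.
  rewrite cintegral_exponential_itv// -mulrA cintegral_exponential_itv ?ltr01//.
  by rewrite exponentialDr exponential0r mulrBr mulr1.
exact: (mulIf w0 E).
Qed.

Lemma unit_transform0 (R : realType) : unit_transform (0 : R) = 1.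
Proof.
rewrite /unit_transform (eq_cintegral (g := fun=> 1)) => [|x _].
  by rewrite -{1}[1]add0r cintegral_cst_unit_itv.
exact: exponential0l.
Qed.

Lemma unit_transform_eq0 (R : realType) (nu : R) :
  (unit_transform nu == 0) = (nu \is a Num.int) && (nu != 0).
Proof.
have [->|nu0] := eqVneq nu 0.
  by rewrite unit_transform0 oner_eq0 andbF.
have w0 : Complex 0 (2 * pi * nu) != 0 :> R[i].
  rewrite eq_complex/= eqxx/= !mulf_neq0//.
  by rewrite gt_eqF// pi_gt0.
rewrite andbT -[X in _ = (X \is a _)]mulr1.
rewrite -exponential_eq1.
have := cintegral_exponential_itv nu (ltr01 : 0 < 1 :> R).
rewrite exponential0r -/(unit_transform nu) => E.
apply/eqP/eqP => [u0|e1]; move/eqP: E.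
  by rewrite u0 mul0r eq_sym subr_eq0 => /eqP.
by rewrite e1 subrr mulf_eq0 (negPf w0) orbF => /eqP.
Qed.

(** * Finite unions of unit intervals *)

Lemma translate_unit_itv (R : realType) (b : R) :
  translate b `]0, 1[%classic = `]b, b + 1[%classic.
Proof.
apply/seteqP; split => x /=; rewrite in_itv/=.
  by move=> [y]; rewrite /= in_itv/= => /andP[y0 y1] <-; rewrite ltrDl y0 ltrD2l.
move=> /andP[bx xb]; exists (x - b); last by rewrite addrC subrK.
by rewrite /= in_itv/= subr_gt0 bx ltrBlDl.
Qed.

(** Two open intervals that meet overlap on an open interval, which has positive
    measure. *)
Lemma essentially_disjoint_trivIset (R : realType) (A : set R) :
  essentially_disjoint A `]0, 1[%classic ->
  trivIset A (fun b => `]b, b + 1[%classic : set R).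
Proof.
move=> dA; apply/trivIsetP => b b' Ab Ab' bb'.
wlog ltbb' : b b' Ab Ab' bb' / b < b'.
  move=> W; have [ltb|ltb|eb] := ltgtP b b'; first exact: W.
    by rewrite setIC; apply: W; rewrite // eq_sym.
  by rewrite eb eqxx in bb'.
rewrite -subset0 => x [] /=; rewrite !in_itv/= => /andP[_ xb] /andP[b'x _].
have := dA b b' Ab Ab' (elimN eqP bb'); rewrite !translate_unit_itv => mu0.
have : (lebesgue_measure (`]b', (b + 1)%R[%classic : set R) <= 0)%E.
  rewrite -mu0; apply: le_measure; rewrite ?inE//=.
    exact: measurableI.
  move=> y /=; rewrite !in_itv/= => /andP[b'y yb].
  rewrite (lt_trans ltbb' b'y) yb b'y/=; split=> //.
  by rewrite (lt_trans yb)// ltrD2r.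
rewrite lebesgue_measure_itv/= lte_fin (lt_trans b'x xb) -EFinB lee_fin.
by rewrite leNgt subr_gt0 (lt_trans b'x xb).
Qed.

Lemma sumset_fset_unit_itv (R : realType) (B : {fset R}) :
  sumset [set` B] `]0, 1[%classic =
  \big[setU/set0]_(b <- B) (`]b, b + 1[%classic : set R).
Proof.
rewrite -bigcup_fset; apply: eq_bigcupr => b _.
exact: translate_unit_itv.
Qed.

Section union_of_unit_intervals.
Variables (R : realType) (B : {fset R}).
Hypothesis hB : essentially_disjoint [set` B] `]0, 1[%classic.

Let S := sumset [set` B] `]0, 1[%classic.

Lemma Rintegral_unit_intervals (f : R -> R) (M : R) :
  measurable_fun setT f -> (forall x, `|f x| <= M) ->
  \int[lebesgue_measure]_(x in S) f x =
  \sum_(b <- B) \int[lebesgue_measure]_(x in `]b, b + 1[) f x.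
Proof.
move=> mf fM.
have fin_cell b : lebesgue_measure.-integrable `]b, b + 1[%classic (EFin \o f).
  apply: (bounded_integrable _ _ mf fM) => //.
  by rewrite lebesgue_measure_unit_itv ltry.
rewrite /Rintegral /S sumset_fset_unit_itv integral_bigsetU_EFin//.
- rewrite -sum_fine// => b _.
  by apply: integrable_fin_num => //; exact: fin_cell.
- exact: essentially_disjoint_trivIset.
- by apply/measurable_EFinP; exact: measurable_funTS.
Qed.

Lemma cintegral_unit_intervals (f : R -> R[i]) :
  bounded_measurable f ->
  cintegral S f = \sum_(b <- B) cintegral `]b, b + 1[ f.
Proof.
move=> [rf jf [M fM]].
rewrite /cintegral.
rewrite (Rintegral_unit_intervals rf (fun x => proj1 (fM x))).
rewrite (Rintegral_unit_intervals jf (fun x => proj2 (fM x))).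
elim: (enum_fset B) => [|b s IH]; first by rewrite !big_nil.
by rewrite !big_cons -IH.
Qed.

(** The integral over [b + I] is [e_nu(b)] times the integral over [I]; as all
    the intervals have length 1, the latter factor is common to all of them. *)
Lemma cintegral_piecewise_exponential (f : R -> R[i]) (v : R -> R[i]) (nu : R) :
  bounded_measurable f ->
  (forall b x, b \in B -> x \in `]b, b + 1[ -> f x = v b * exponential nu x) ->
  cintegral S f = (\sum_(b <- B) v b * exponential nu b) * unit_transform nu.
Proof.
move=> bf fE; rewrite cintegral_unit_intervals// mulr_suml.
rewrite big_seq [RHS]big_seq; apply: eq_bigr => b Bb.
rewrite (eq_cintegral (g := fun x => v b * exponential nu x)); last first.
  by move=> x xb; exact: fE.
rewrite cintegralZ//; first by rewrite cintegral_exponential_translate mulrA.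
- by rewrite lebesgue_measure_unit_itv ltry.
- exact: bounded_measurable_exponential.
Qed.

Lemma L2inner_exponential (lam mu : R) :
  L2inner S (exponential lam) (exponential mu) =
  (\sum_(b <- B) exponential (lam - mu) b) * unit_transform (lam - mu).
Proof.
have bmE := @bounded_measurable_exponential R.
rewrite /L2inner (cintegral_piecewise_exponential (v := fun=> 1) (nu := lam - mu)).
- by under eq_bigr do rewrite mul1r.
- by apply: bounded_measurableM => //; exact: bounded_measurable_conjc.
- by move=> b x _ _; rewrite mul1r conjc_exponential exponentialDl.
Qed.

(** A trigonometric function of frequency [lam] whose amplitude [v b] may
    change from one unit interval [b + I] to the other. *)
Definition piecewise_exponential (v : R -> R[i]) (lam x : R) : R[i] :=
  (\sum_(b <- B) (\1_(`]b, b + 1[%classic) x)%:C%C * v b) * exponential lam x.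

Lemma piecewise_exponentialE (v : R -> R[i]) (lam b x : R) :
  b \in B -> x \in `]b, b + 1[ ->
  piecewise_exponential v lam x = v b * exponential lam x.
Proof.
move=> Bb xb; rewrite /piecewise_exponential; congr (_ * _).
rewrite (big_rem b)//= indicE mem_set// mul1r big_seq big1 ?addr0// => b'.
rewrite mem_rem_uniq ?fset_uniq// => /andP[bb' Bb'].
rewrite indicE memNset ?mul0r// => /= xb'.
have /trivIsetP := essentially_disjoint_trivIset hB.
by move=> /(_ b' b Bb' Bb bb'); rewrite -subset0; apply; split; [exact: xb'|exact: xb].
Qed.

Lemma bounded_measurable_piecewise_exponential (v : R -> R[i]) (lam : R) :
  bounded_measurable (piecewise_exponential v lam).
Proof.
apply: bounded_measurableM; last exact: bounded_measurable_exponential.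
apply: bounded_measurable_sum => b.
apply: bounded_measurableM; last exact: bounded_measurable_cst.
exact: bounded_measurable_indic.
Qed.

End union_of_unit_intervals.

(** * Orthogonality and totality in the square-integrable functions *)

Section L2_of_bounded_functions.
Variables (R : realType) (S : set R).
Hypotheses (mS : measurable S) (finS : (lebesgue_measure S < +oo)%E).

Let sqnorm (f : R -> R[i]) (x : R) : R :=
  (complex.Re (f x)) ^+ 2 + (complex.Im (f x)) ^+ 2.

Let integrable_Re (f : R -> R[i]) : bounded_measurable f ->
  lebesgue_measure.-integrable S (EFin \o (fun x => complex.Re (f x))).
Proof. by move=> /(bounded_measurable_integrable mS finS) []. Qed.

Let sqnormE (f : R -> R[i]) (x : R) :
  sqnorm f x = complex.Re (f x * conjc (f x)).
Proof. by rewrite /sqnorm; case: (f x) => a b /=; ring. Qed.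

Let integrable_sqnorm (f : R -> R[i]) : bounded_measurable f ->
  lebesgue_measure.-integrable S (EFin \o sqnorm f).
Proof.
move=> bf; rewrite (funext (sqnormE f)).
apply: integrable_Re; apply: bounded_measurableM => //.
exact: bounded_measurable_conjc.
Qed.

Let Re_L2inner (f : R -> R[i]) :
  complex.Re (L2inner S f f) = \int[lebesgue_measure]_(x in S) sqnorm f x.
Proof. by apply: eq_Rintegral => x _; rewrite sqnormE. Qed.

Lemma L2normsq_bounded_measurable (f : R -> R[i]) : bounded_measurable f ->
  L2normsq S f = (complex.Re (L2inner S f f))%:E.
Proof.
move=> bf; rewrite Re_L2inner /Rintegral fineK//.
by apply: integrable_fin_num => //; exact: integrable_sqnorm.
Qed.

Lemma L2_bounded_measurable (f : R -> R[i]) : bounded_measurable f -> L2 S f.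
Proof.
move=> bf; have [rf jf _] := bf; split; [exact: measurable_funTS ..|].
by rewrite L2normsq_bounded_measurable// ltry.
Qed.

(** This is the integral of the pointwise inequality
    [|f|^2 - 2 Re (f conj(g)) <= |f - g|^2], where the middle term integrates to
    zero. *)
Lemma L2normsq_le_orthogonal (f g : R -> R[i]) :
  bounded_measurable f -> bounded_measurable g -> L2inner S f g = 0 ->
  (L2normsq S f <= L2normsq S (fun x => (f x - g x)%R))%E.
Proof.
move=> bf bg fg0.
have bgJ := bounded_measurable_conjc bg.
have bd : bounded_measurable (fun x => f x - g x).
  have := bounded_measurableD bf
    (bounded_measurableM (bounded_measurable_cst (-1)) bg).
  by under eq_fun do rewrite mulN1r.
rewrite !L2normsq_bounded_measurable// lee_fin !Re_L2inner.
pose k x := complex.Re (f x * conjc (g x)); pose h x := 2 * k x.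
have ik : lebesgue_measure.-integrable S (EFin \o k).
  exact/integrable_Re/bounded_measurableM.
have ih : lebesgue_measure.-integrable S (EFin \o h).
  rewrite (_ : EFin \o h = (fun x => 2%:E * (EFin \o k) x)%E)//.
  exact: integrableZl.
have h0 : \int[lebesgue_measure]_(x in S) h x = 0.
  rewrite RintegralZl// [X in 2 * X](_ : _ = 0) ?mulr0//.
  exact: (congr1 (@complex.Re R) fg0).
rewrite -[leLHS]subr0 -h0 -RintegralB//; last exact: integrable_sqnorm.
apply: le_Rintegral => // [||x _].
- rewrite (_ : EFin \o _ = (EFin \o sqnorm f) \- (EFin \o h))%E//.
  by apply: integrableB => //; exact: integrable_sqnorm.
- exact: integrable_sqnorm.
rewrite /sqnorm /h /k; case: (f x) (g x) => [a b] [c d] /=.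
rewrite -subr_ge0 (_ : _ - _ = c ^+ 2 + d ^+ 2); last by ring.
by rewrite addr_ge0// sqr_ge0.
Qed.

Lemma L2inner_suml (I : Type) (s : seq I) (c : I -> R[i]) (e : I -> R -> R[i])
    (f : R -> R[i]) :
  bounded_measurable f -> (forall i, bounded_measurable (e i)) ->
  L2inner S f (fun x => \sum_(i <- s) c i * e i x) =
  \sum_(i <- s) conjc (c i) * L2inner S f (e i).
Proof.
move=> bf be.
have bfe i : bounded_measurable (fun x => f x * conjc (e i x)).
  by apply: bounded_measurableM => //; exact: bounded_measurable_conjc.
rewrite /L2inner (eq_cintegral (g :=
  fun x => \sum_(i <- s) conjc (c i) * (f x * conjc (e i x)))).
  rewrite cintegral_sum//.
    by apply: eq_bigr => i _; rewrite cintegralZ.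
  by move=> i; apply: bounded_measurableM => //; exact: bounded_measurable_cst.
move=> x _; rewrite rmorph_sum mulr_sumr; apply: eq_bigr => i _.
by rewrite rmorphM mulrCA.
Qed.

(** Density of the span of a basis makes it total: the distance from a
    function orthogonal to the basis to that span is its own norm. *)
Lemma orthogonal_basis_total (J : choiceType) (D : set J) (e : J -> R -> R[i])
    (f : R -> R[i]) :
  orthogonal_basis S D e -> (forall j, bounded_measurable (e j)) ->
  bounded_measurable f -> (forall j, D j -> L2inner S f (e j) = 0) ->
  L2normsq S f = 0.
Proof.
move=> [_ _ dense] be bf f0.
have n0 : (0 <= L2normsq S f)%E.
  by apply: integral_ge0 => x _; rewrite lee_fin addr_ge0// sqr_ge0.
have nE := L2normsq_bounded_measurable bf.
rewrite nE lee_fin in n0 *.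
set r := complex.Re _ in nE n0 *.
have [->//|rn0] := eqVneq r 0.
have r0 : 0 < r by rewrite lt_neqAle eq_sym rn0.
have sr0 : 0 < Num.sqrt r by rewrite sqrtr_gt0.
have [F [c [FD]]] := dense f (L2_bounded_measurable bf) _ sr0.
rewrite sqr_sqrtr// -nE ltNge => /negP[].
apply: L2normsq_le_orthogonal => //.
  apply: bounded_measurable_sum => j; apply: bounded_measurableM => //.
  exact: bounded_measurable_cst.
rewrite L2inner_suml// big_seq big1// => j Fj.
by rewrite f0 ?mulr0//; exact: FD.
Qed.

End L2_of_bounded_functions.

(** * The two conditions carried by a spectral pair *)

(** The Fourier transform of the counting measure on [B], at the frequency
    [- nu]. *)
Definition mask (R : realType) (B : {fset R}) (nu : R) : R[i] :=
  \sum_(b <- B) exponential nu b.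

Section spectral_pair_conditions.
Variables (R : realType) (B : {fset R}) (Lam : set R).
Hypothesis hB : essentially_disjoint [set` B] `]0, 1[%classic.
Hypothesis hsp : spectral_pair (sumset [set` B] `]0, 1[%classic) Lam.

Lemma spectral_pair_mask (lam mu : R) :
  Lam lam -> Lam mu -> lam - mu \isn't a Num.int -> mask B (lam - mu) = 0.
Proof.
case: hsp => mS /andP[_ finS] [_ orth _] Ll Lm nint.
have lm : lam <> mu by move=> lm; rewrite lm subrr rpred0 in nint.
have := orth _ _ Ll Lm lm; rewrite L2inner_exponential// => /eqP.
rewrite mulf_eq0 [X in _ || X]unit_transform_eq0 (negPf nint) orbF.
by move=> /eqP.
Qed.

(** The function equal to [v_b e_lam] on [b + I] is orthogonal to the whole
    basis: where the hypothesis says nothing, [lam - mu] is a nonzero integer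
    and [e_(lam - mu)] has mean zero on each interval. Hence its squared norm,
    the sum of the [|v_b|^2], is zero. *)
Lemma spectral_pair_total (v : R -> R[i]) (lam : R) :
  (forall mu, Lam mu -> lam - mu = 0 \/ lam - mu \isn't a Num.int ->
     \sum_(b <- B) v b * exponential (lam - mu) b = 0) ->
  forall b, b \in B -> v b = 0.
Proof.
case: hsp => mS /andP[_ finS] basis v0 b Bb.
have bmf := bounded_measurable_piecewise_exponential B v lam.
set f := piecewise_exponential B v lam in bmf.
have fperp mu : Lam mu ->
    L2inner (sumset [set` B] `]0, 1[%classic) f (exponential mu) = 0.
  move=> Lm; rewrite /L2inner.
  rewrite (cintegral_piecewise_exponential hB (v := v) (nu := lam - mu)).
  - have [/andP[int n0]|] := boolP ((lam - mu \is a Num.int) && (lam - mu != 0)).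
      by rewrite (eqP (_ : unit_transform _ == 0)) ?mulr0// unit_transform_eq0 int.
    rewrite negb_and negbK => nint; rewrite v0 ?mul0r//.
    by case/orP: nint => [|/eqP]; [right|left].
  - apply: bounded_measurableM => //; apply: bounded_measurable_conjc.
    exact: bounded_measurable_exponential.
  move=> c x Bc xc; rewrite /f (piecewise_exponentialE hB _ _ Bc xc).
  rewrite conjc_exponential.
  by rewrite -mulrA -exponentialDl.
have := orthogonal_basis_total mS finS basis
  (@bounded_measurable_exponential R) bmf fperp.
rewrite L2normsq_bounded_measurable// /L2inner.
rewrite (cintegral_piecewise_exponential hB
  (v := fun c => v c * conjc (v c)) (nu := 0)).
- rewrite unit_transform0 mulr1 (big_morph (@complex.Re R) (@ReD R) erefl).
  have sqE c : complex.Re (v c * conjc (v c) * exponential 0 c) =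
      complex.Re (v c) ^+ 2 + complex.Im (v c) ^+ 2.
    by rewrite exponential0l mulr1; case: (v c) => x y /=; ring.
  under eq_bigr do rewrite sqE.
  move=> -[] /eqP; rewrite psumr_eq0 => [|c _]; last by rewrite addr_ge0 ?sqr_ge0.
  move=> /allP/(_ _ Bb)/=; rewrite paddr_eq0 ?sqr_ge0// !sqrf_eq0.
  by case: (v b) => x y /= /andP[/eqP -> /eqP ->].
- by apply: bounded_measurableM => //; exact: bounded_measurable_conjc.
move=> c x Bc xc; rewrite /f (piecewise_exponentialE hB _ _ Bc xc) rmorphM.
rewrite [X in _ * (_ * X)]conjc_exponential.
by rewrite mulrACA -exponentialDl subrr.
Qed.

End spectral_pair_conditions.

(** * The spectrum of a union of unit intervals *)

Lemma eq_of_sub_int (R : realType) (x y : R) :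
  0 <= x < 1 -> 0 <= y < 1 -> x - y \is a Num.int -> x = y.
Proof.
move=> /andP[x0 x1] /andP[y0 y1] int; apply/eqP; rewrite -subr_eq0.
apply: contraT => /(norm_intr_ge1 int); rewrite leNgt => /negP[].
by rewrite ltr_norml; apply/andP; split; lra.
Qed.

Lemma fractional_part_itv (R : realType) (x : R) :
  0 <= x - (Num.floor x)%:~R < 1.
Proof.
rewrite subr_ge0 floor_le ltrBlDl -[X in _ + X]/(1%:~R) -intrD.
exact: floorD1_gt.
Qed.

Lemma big_fset_enum (R : realType) (M : nmodType) (A : {fset R}) (F : R -> M) :
  \sum_(a <- A) F a = \sum_(i < #|` A|) F (enum_fset A)`_i.
Proof. by rewrite (big_nth 0) big_mkord. Qed.

(** The scalar product of the columns [l] and [l'] is [B^(l' - l) / |B|]. The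
    condition [U U^* = 1] for the adjoint of the matrix expresses that its
    columns are orthonormal, which makes sense before [L] is known to have as
    many elements as [B]. *)
Lemma adjoint_exponential_matrix_unitary (R : realType) (B L : {fset R}) :
  (0 < #|` B|)%N ->
  (forall l l', l \in L -> l' \in L -> l <> l' -> mask B (l - l') = 0) ->
  map_mx Num.conj (exponential_matrix B L)^T \is unitarymx.
Proof.
move=> B0 orth; apply/unitarymxP/matrixP => i j.
rewrite !mxE.
have conjE (z : R[i]) : Num.conj z = conjc z by [].
have entry (k : 'I_#|` B|) : map_mx Num.conj (exponential_matrix B L)^T i k *
    (map_mx Num.conj (map_mx Num.conj (exponential_matrix B L)^T)^T) k j =
    #|` B|%:R^-1 *
      exponential ((enum_fset L)`_j - (enum_fset L)`_i) (enum_fset B)`_k.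
  rewrite !mxE conjCK rmorphM/= !conjE conjc_real conjc_exponential mulrACA.
  rewrite -exponentialDl addrC -rmorphM/= -invfM -expr2 sqr_sqrtr//.
  by rewrite fmorphV rmorph_nat.
under eq_bigr do rewrite entry.
rewrite -mulr_sumr -big_fset_enum -/(mask B _).
have [->|ij] := eqVneq i j.
  rewrite subrr /mask; under eq_bigr do rewrite exponential0l.
  rewrite big_const_seq count_predT iter_addr_0 mulVf//.
  by rewrite pnatr_eq0 -lt0n.
rewrite orth ?mulr0//; try exact: mem_nth.
move=> /eqP; rewrite nth_uniq ?fset_uniq// => /eqP ji.
by move/eqP: ij; apply; apply: val_inj.
Qed.

Lemma unitary_of_adjoint (C : numClosedFieldType) (m n : nat) (U : 'M[C]_(m, n)) :
  n = m -> map_mx Num.conj U^T \is unitarymx -> unitary U.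
Proof.
move=> nm; case: m / nm U => U UU; split=> //.
by move: UU; rewrite trmxC_unitary.
Qed.

(** The two hypotheses on [Lam] below are the orthogonality and the totality of
    the spectrum, stripped of all analysis. *)
Section spectrum_of_union_of_unit_intervals.
Variables (R : realType) (B : {fset R}) (Lam : set R).
Hypothesis B0 : (0 < #|` B|)%N.
Hypothesis orth : forall lam mu : R,
  Lam lam -> Lam mu -> lam - mu \isn't a Num.int -> mask B (lam - mu) = 0.
Hypothesis total : forall (v : R -> R[i]) (lam : R),
  (forall mu, Lam mu -> lam - mu = 0 \/ lam - mu \isn't a Num.int ->
     \sum_(b <- B) v b * exponential (lam - mu) b = 0) ->
  forall b, b \in B -> v b = 0.

Let b0 : R := (enum_fset B)`_0.
Let Bb0 : b0 \in B. Proof. exact: mem_nth. Qed.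

Lemma spectrum_nonempty : exists lam, Lam lam.
Proof.
apply: contrapT => /forallNP noLam.
have /eqP := total (v := fun=> 1) (lam := 0)
  (fun mu Lm => False_ind _ (noLam mu Lm)) Bb0.
by rewrite oner_eq0.
Qed.

(** If [lam + s] were not in the spectrum, the function equal to
    [e_(-s)(b) e_(lam + s)] on [b + I] would be orthogonal to all of it. *)
Lemma spectrum_periodic (lam s : R) :
  s \is a Num.int -> Lam lam -> Lam (lam + s).
Proof.
move=> ints Ll; apply: contrapT => nLls.
have /eqP : exponential (- s) b0 = 0; last by rewrite (negPf (exponential_neq0 _ _)).
apply: (total (v := exponential (- s)) (lam := lam + s)) => // mu Lm [/eqP|nint].
  by rewrite subr_eq0 => /eqP lsm; rewrite lsm in nLls.
under eq_bigr do rewrite -exponentialDl addrA (addrC (- s)) addrK.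
apply: orth => //; apply: contraNN nint => int.
by rewrite addrAC rpredD.
Qed.

(** With [s = 1], the component of the modulated function along [e_(lam + 1)]
    is [c e_(lam + 1)], where [c] is the mean of [e_(-1)] over [B]. Subtracting
    it leaves a function orthogonal to the whole spectrum, so that [e_(-1)] is
    constant on [B]. *)
Lemma sub_int_of_spectrum (b b' : R) :
  b \in B -> b' \in B -> b - b' \is a Num.int.
Proof.
have [lam Ll] := spectrum_nonempty.
have Ll1 : Lam (lam + 1) by exact: spectrum_periodic.
pose c : R[i] := mask B (-1) / #|` B|%:R.
have cE a : a \in B -> exponential (-1) a = c.
  move=> Ba; apply/eqP; rewrite -subr_eq0; apply/eqP.
  apply: (total (v := fun a => exponential (-1) a - c) (lam := lam + 1)) => // mu Lm.
  move=> lm1.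
  under eq_bigr do rewrite mulrBl.
  rewrite sumrB -mulr_sumr -/(mask B _); case: lm1 => [->|nint].
    under eq_bigr do rewrite exponential0l mulr1.
    rewrite -/(mask B _) {2}/mask.
    under [X in _ - _ * X]eq_bigr do rewrite exponential0l.
    rewrite big_const_seq count_predT iter_addr_0 divfK ?subrr//.
    by rewrite pnatr_eq0 -lt0n.
  rewrite (orth Ll1)// mulr0 subr0.
  under eq_bigr do rewrite -exponentialDl addrA (addrC (-1)) addrK.
  apply: orth => //; apply: contraNN nint => int.
  by rewrite addrAC rpredD ?rpred1.
move=> Bb Bb'; rewrite -[_ - _]mul1r -exponential_eq1 exponentialDr.
have -> : exponential 1 (- b') = exponential (-1) b.
  by rewrite (cE b)// -(cE b')// /exponential !(mulrN, mulNr).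
by rewrite exponentialVl.
Qed.

Lemma spectrum_fset_card (L : {fset R}) :
  [set` L] `<=` Lam `&` [set x | 0 <= x < 1] -> (#|` L| <= #|` B|)%N.
Proof.
move=> sub.
have U : map_mx Num.conj (exponential_matrix B L)^T \is unitarymx.
  apply: adjoint_exponential_matrix_unitary => // l l' Ll Ll' ll'.
  have [[Laml l01] [Laml' l'01]] := (sub l Ll, sub l' Ll').
  by apply: orth => //; apply/negP => /(eq_of_sub_int l01 l'01).
by rewrite -(mxrank_unitary U) rank_leq_col.
Qed.

Lemma spectrum_representatives : exists L : {fset R},
  [set` L] = Lam `&` [set x | 0 <= x < 1].
Proof.
suff /finite_fsetP[L LE] : finite_set (Lam `&` [set x | 0 <= x < 1]) by exists L.
apply: contrapT => /(infinite_set_fset #|` B|.+1)[F /spectrum_fset_card].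
by rewrite leqNgt => /negP.
Qed.

(** If [L] had fewer elements than [B], there would be a nonzero vector [v]
    orthogonal to all [(e_l(b))_b]. As [B] is contained in one class modulo the
    integers, [e_(l + k)] restricted to [B] is a multiple of [e_l] for every
    integer [k], so [v] would be orthogonal to the whole spectrum. *)
Lemma spectrum_card_ge (L : {fset R}) :
  [set` L] = Lam `&` [set x | 0 <= x < 1] -> (#|` B| <= #|` L|)%N.
Proof.
move=> LE; rewrite leqNgt; apply/negP => LB.
pose M : 'M[R[i]]_(#|` B|, #|` L|) :=
  \matrix_(i, j) exponential (- (enum_fset L)`_j) (enum_fset B)`_i.
have : kermx M != 0.
  by rewrite kermx_eq0 /row_free neq_ltn (leq_ltn_trans (rank_leq_col M) LB).
move=> /rowV0Pn[v /sub_kermxP vM]; apply/negP; rewrite negbK; apply/eqP.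
pose w (b : R) : R[i] := if insub (index b B) is Some i then v 0 i else 0.
have wE (i : 'I_#|` B|) : w (enum_fset B)`_i = v 0 i.
  by rewrite /w index_uniq ?fset_uniq//= valK.
apply/rowP => i; rewrite -wE mxE.
apply: (total (v := w) (lam := 0)) => [mu Lm _|]; last exact: mem_nth.
pose l := mu - (Num.floor mu)%:~R.
have : l \in L.
  suff : [set` L] l by [].
  rewrite LE; split; first by apply: spectrum_periodic; rewrite // rpredN intr_int.
  exact: fractional_part_itv.
move=> lL.
have jP : (index l L < #|` L|)%N by rewrite index_mem.
have := congr1 (fun N : 'rV_#|` L| => N 0 (Ordinal jP)) vM; rewrite !mxE => sum0.
transitivity (exponential (l - mu) b0 * \sum_(b <- B) w b * exponential (- l) b).
  rewrite mulr_sumr big_seq [RHS]big_seq; apply: eq_bigr => b Bb.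
  rewrite mulrCA; congr (_ * _).
  have -> : exponential (l - mu) b0 = exponential (l - mu) b.
    rewrite -[b](subrK b0) exponentialDr.
    rewrite (eqP (_ : exponential _ (b - b0) == 1)) ?mul1r//.
    rewrite exponential_eq1 rpredM//; last exact: sub_int_of_spectrum.
    by rewrite /l addrAC subrr sub0r rpredN intr_int.
  by rewrite -exponentialDl addrAC subrr.
rewrite big_fset_enum [X in _ * X](_ : _ = 0) ?mulr0// -[RHS]sum0.
by apply: eq_bigr => k _; rewrite wE mxE/= nth_index.
Qed.

End spectrum_of_union_of_unit_intervals.

Theorem corollary2p4p1 (R : realType) (B : {fset R}) (Lam : set R)
    (hB : essentially_disjoint [set` B] `]0, 1[%classic)
    (hsp : spectral_pair (sumset [set` B] `]0, 1[%classic) Lam) :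
  exists L : {fset R},
    [/\ #|` L| = #|` B|,
        Lam = sumset [set` L] (@integers R),
        trivIset [set` L] (fun l => translate l (@integers R)),
        forall b b' : R, b \in B -> b' \in B -> b - b' \is a Num.int &
        unitary (exponential_matrix B L)].
Proof.
have B0 : (0 < #|` B|)%N.
  case: hsp => _ /andP[S0 _] _; rewrite lt0n cardfs_eq0; apply/eqP => BE.
  move: S0; rewrite BE sumset_fset_unit_itv (_ : enum_fset fset0 = [::]).
    by rewrite big_nil measure0 ltxx.
  by apply/eqP; rewrite -size_eq0 cardfs0.
have orth := spectral_pair_mask hB hsp.
have total := spectral_pair_total hB hsp.
have [L LE] := spectrum_representatives B0 orth.
have memL l : l \in L -> Lam l /\ 0 <= l < 1.
  move=> lL; suff [] : (Lam `&` [set x | 0 <= x < 1]) l by [].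
  by rewrite -LE.
have cardL : #|` L| = #|` B|.
  apply/eqP; rewrite eqn_leq (spectrum_fset_card B0 orth) ?LE//.
  exact: spectrum_card_ge B0 orth total _ LE.
exists L; split => //.
- apply/seteqP; split => [mu Lm|_ [l /memL[Ll _]] [k intk <-]]; last first.
    exact: spectrum_periodic B0 orth total _ _ intk Ll.
  exists (mu - (Num.floor mu)%:~R).
    rewrite LE; split.
      by apply: (spectrum_periodic B0 orth total); rewrite ?rpredN ?intr_int.
    exact: fractional_part_itv.
  by exists (Num.floor mu)%:~R; rewrite ?subrK//; exact: intr_int.
- move=> l l' /memL[_ l01] /memL[_ l'01] [x [[k /= intk kE] [k' /= intk' k'E]]].
  apply: eq_of_sub_int => //.
  rewrite (_ : l - l' = k' - k); first by rewrite rpredB.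
  by apply/eqP; rewrite subr_eq addrAC eq_sym subr_eq addrC k'E -kE.
- exact: sub_int_of_spectrum B0 orth total.
- apply: unitary_of_adjoint => //.
  apply: adjoint_exponential_matrix_unitary => // l l'.
  move=> /memL[Ll l01] /memL[Ll' l'01] ll'.
  by apply: orth => //; apply/negP => /(eq_of_sub_int l01 l'01).
Qed.
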